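(* $\check\kappa(2,1) = 2$, $\check\kappa(3,1) = 3$, $\check\kappa(3,2) = 2$, $\check\kappa(4,2) = \check\kappa(5,2) = \check\kappa(6,2) = 3$, and $\check\kappa(5,3) = 2$.
   Context: All graphs are finite and simple. An interval graph is the intersection graph of a finite family of open intervals of the real line. The claw number of a graph $G$ is the largest integer $v \ge 0$ such that the star $K_{1,v}$ is an induced subgraph of $G$. For $w \ge v \ge 1$, $\check\kappa(w,v)$ denotes the smallest integer $k$ such that every interval graph with claw number at most $w$ admits a partition of its vertex set into $k$ subsets each inducing a subgraph with claw number at most $v$. *)

(* Defs.v *)
From HB Require Import structures.
From mathcomp Require Import all_boot all_order all_algebra.
From mathcomp Require Import classical_sets set_interval reals.

Set Implicit Arguments.
Unset Strict Implicit.
Unset Printing Implicit Defensive.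

Import Order.TTheory GRing.Theory Num.Theory.

Record sgraph := SGraph {
  vertex :> finType;
  adj : rel vertex;
  adj_sym : symmetric adj;
  adj_irr : irreflexive adj
}.

Section Induced.
Variables (G : sgraph) (A : {set G}).

Definition induced_adj : rel {x : G | x \in A} :=
  fun x y => adj (val x) (val y).

Lemma induced_adj_sym : symmetric induced_adj.
Proof. by move=> x y; apply: adj_sym. Qed.

Lemma induced_adj_irr : irreflexive induced_adj.
Proof. by move=> x; apply: adj_irr. Qed.

Definition induced : sgraph := SGraph induced_adj_sym induced_adj_irr.
End Induced.

(* The star K_{1,v}: [None] is the centre, the [Some i] are the v leaves. *)
Section Star.
Variable v : nat.

Definition star_adj : rel (option 'I_v) := fun x y => isSome x != isSome y.

Lemma star_adj_sym : symmetric star_adj.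
Proof. by move=> x y; rewrite /star_adj eq_sym. Qed.

Lemma star_adj_irr : irreflexive star_adj.
Proof. by move=> x; rewrite /star_adj eqxx. Qed.

Definition star : sgraph := SGraph star_adj_sym star_adj_irr.
End Star.

(* H is isomorphic to an induced subgraph of G. *)
Definition induced_subgraph (H G : sgraph) : bool :=
  [exists f : {ffun H -> G},
     injectiveb f && [forall x, forall y, adj (f x) (f y) == adj x y]].

(* K_{1,v} has v.+1 vertices, so only v < #|G| can occur. The claw number of
   the graph without vertices, which contains no K_{1,v} at all, is 0. *)
Definition claw_number (G : sgraph) : nat :=
  \max_(v < #|G| | induced_subgraph (star v) G) v.

Lemma induced_star_lt_card (G : sgraph) (v : nat) :
  induced_subgraph (star v) G -> v < #|G|.
Proof.
case/existsP=> f /andP[/injectiveP f_inj _].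
by have := leq_card f f_inj; rewrite card_option card_ord.
Qed.

Lemma leq_claw_number (G : sgraph) (v : nat) :
  induced_subgraph (star v) G -> v <= claw_number G.
Proof.
move=> vG; have ltvG := induced_star_lt_card vG.
exact: (@leq_bigmax_cond _ (fun i : 'I_#|G| => induced_subgraph (star i) G)
          (fun i => i : nat) (Ordinal ltvG)).
Qed.

Lemma induced_star_claw_number (G : sgraph) :
  0 < #|G| -> induced_subgraph (star (claw_number G)) G.
Proof.
move=> G0; have star0 : induced_subgraph (star 0) G.
  have [x _] := card_gt0P G0.
  apply/existsP; exists [ffun=> x]; apply/andP; split.
    by apply/injectiveP => -[[]//|] [[]//|].
  by apply/forallP => -[[]//|]; apply/forallP => -[[]//|]; rewrite !ffunE !adj_irr.
rewrite /claw_number (bigop.bigmax_eq_arg (Ordinal G0)) //.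
by case: arg_maxnP.
Qed.

(* The family is indexed by the vertices, so intervals may be repeated. *)
Definition interval_graph (R : realType) (G : sgraph) : Prop :=
  exists l r : G -> R,
    (forall x, (l x < r x)%R) /\
    (forall x y, x != y ->
       (adj x y <-> (`]l x, r x[ `&` `]l y, r y[ !=set0)%classic)).

(* The vertex set is partitioned into k subsets; since k does not depend on the
   graph, some of them may be empty. *)
Definition claw_partition (G : sgraph) (k v : nat) : Prop :=
  exists P : 'I_k -> {set G},
    [/\ forall i j, i != j -> [disjoint P i & P j],
        \bigcup_(i < k) P i = [set: G]%SET
      & forall i, claw_number (induced (P i)) <= v].

Definition kappa_bound (R : realType) (w v k : nat) : Prop :=
  forall G : sgraph,
    interval_graph R G -> claw_number G <= w -> claw_partition G k v.

(* [is_kappa R w v k] says that the minimum defining the function kappa at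
   (w, v) exists and equals k. *)
Definition is_kappa (R : realType) (w v k : nat) : Prop :=
  kappa_bound R w v k /\ forall j, kappa_bound R w v j -> k <= j.

(* Main.v *)
(* Let [h t] be the largest number of pairwise disjoint intervals that end by
   [t]. The points where [h] jumps stab every interval [x], and those in [x] are
   numbered from [a x = h (l x) + 1] to [b x = h (r x)]. If the claw number is at
   most [w], then [b x < a x + w], and [a y < a x + w] whenever [x] and [y] are
   adjacent.
   - Group the vertices by blocks of [v] consecutive values of [a], and colour
     the blocks cyclically with [k] colours. If [w <= (k - 1) * v + 1], there is
     no edge between two blocks of the same colour, so each class is a disjoint
     union of graphs covered by [v] cliques. This settles (2,1), (3,1), (3,2).
   - For (5,3), one class consists of the intervals that contain a stabbing point
     whose index is a multiple of 4. The other intervals split at these points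
     into groups stabbed by 3 points. For (6,2), cut in the same way at the
     multiples of 9, and cut the rest at the multiples of 3. A claw in the class
     of the cut intervals would need an interval that contains or touches too
     many stabbing points.
   - For the lower bounds other than stars, take all intervals with integer ends
     in [0, N] and length from [K] to [(w - 1) * K + 1]; their graph has claw
     number at most [w]. An exhaustive search shows that it has no 2-colouring
     with classes of claw number at most 1 for [K = 1, w = 3, N = 5], and none
     with classes of claw number at most 2 for [K = 2, w = 4, N = 22]. *)

Require Import Defs.
From mathcomp Require Import classical_sets set_interval reals.
From mathcomp Require Import all_boot all_order all_algebra zify.

Set Implicit Arguments.
Unset Strict Implicit.
Unset Printing Implicit Defensive.

Import Order.TTheory GRing.Theory Num.Theory.

(** * Claw numbers through independent sets of neighbours *)

Definition independent (G : sgraph) (Y : {set G}) : bool :=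
  [forall y in Y, forall z in Y, ~~ adj y z].

Lemma independentP (G : sgraph) (Y : {set G}) :
  reflect {in Y &, forall y z, ~~ adj y z} (independent Y).
Proof.
apply: (iffP forall_inP) => [H y z /H /forall_inP|H y Yy]; first exact.
by apply/forall_inP => z; apply: H.
Qed.

Lemma leq_claw_number_set (G : sgraph) (x : G) (Y : {set G}) :
  {in Y, forall y, adj x y} -> independent Y -> #|Y| <= claw_number G.
Proof.
move=> adjY /independentP indY; apply: leq_claw_number; apply/existsP.
pose f (o : option 'I_#|Y|) := if o is Some i then enum_val i else x.
exists [ffun o : star #|Y| => f o]; apply/andP; split.
  apply/injectiveP => -[i|] [j|]; rewrite !ffunE //=.
  - by move/enum_val_inj->.
  - by move=> E; have := adjY _ (enum_valP i); rewrite E adj_irr.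
  - by move=> E; have := adjY _ (enum_valP j); rewrite -E adj_irr.
apply/forallP => -[i|]; apply/forallP => -[j|]; rewrite !ffunE /= /star_adj /=.
- by rewrite (negbTE (indY _ _ (enum_valP i) (enum_valP j))).
- by rewrite adj_sym adjY // enum_valP.
- by rewrite adjY // enum_valP.
- by rewrite adj_irr.
Qed.

Lemma claw_number_leq (G : sgraph) (v : nat) :
    (forall (x : G) (Y : {set G}),
       {in Y, forall y, adj x y} -> independent Y -> #|Y| <= v) ->
  claw_number G <= v.
Proof.
move=> H; case: (posnP #|G|) => [G0|]; last move/induced_star_claw_number.
  by rewrite /claw_number big1 // => i; have := ltn_ord i; rewrite {2}G0.
set u := claw_number G; case/existsP => f /andP[/injectiveP f_inj /forallP f_adj].
have adjf o o' : adj (f o) (f o') = @adj (star u) o o'.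
  by have /forallP/(_ o')/eqP := f_adj o.
suff -> : u = #|[set f (Some i) | i : 'I_u]|.
  apply: (H (f None)) => [_ /imsetP[i _ ->]|]; first by rewrite adjf.
  by apply/independentP => _ _ /imsetP[i _ ->] /imsetP[j _ ->]; rewrite adjf.
by rewrite card_imset ?card_ord // => i j /f_inj[].
Qed.

Lemma claw_number_induced_leq (G : sgraph) (A : {set G}) (v : nat) :
    (forall (x : G) (Y : {set G}), x \in A -> Y \subset A ->
       {in Y, forall y, adj x y} -> independent Y -> #|Y| <= v) ->
  claw_number (induced A) <= v.
Proof.
move=> H; apply: claw_number_leq => x Y adjY /independentP indY.
rewrite -(card_imset _ val_inj); apply: (H (val x)); first exact: valP.
- by apply/subsetP => _ /imsetP[y _ ->]; apply: valP.
- by move=> _ /imsetP[y Yy ->]; apply: adjY.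
- by apply/independentP => _ _ /imsetP[y Yy ->] /imsetP[z Yz ->]; apply: indY.
Qed.

Lemma leq_claw_number_induced (G : sgraph) (A : {set G}) (x : G) (Y : {set G}) :
    x \in A -> Y \subset A -> {in Y, forall y, adj x y} -> independent Y ->
  #|Y| <= claw_number (induced A).
Proof.
move=> Ax /subsetP sYA adjY /independentP indY.
pose Y' := [set y : induced A | val y \in Y].
suff -> : #|Y| = #|Y'|.
  apply: (@leq_claw_number_set (induced A) (exist _ x Ax)).
    by move=> y; rewrite inE => /adjY.
  by apply/independentP => y z; rewrite !inE; apply: indY.
rewrite -(card_imset _ val_inj); apply: eq_card => y; apply/idP/imsetP.
  by move=> Yy; exists (exist _ y (sYA _ Yy)); rewrite ?inE.
by case=> z; rewrite inE => Yz ->.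
Qed.

(** Colours in [nat] allow arithmetic formulas; classes from [k] on are empty. *)
Lemma claw_partitionP (G : sgraph) (k v : nat) :
  claw_partition G k v <->
  exists c : G -> nat, (forall x, c x < k) /\
    forall i, claw_number (induced [set x | c x == i]) <= v.
Proof.
split=> [[P [disjP covP clawP]]|[c [ltck clawc]]].
  have inP x : exists i, x \in P i.
    have : x \in \bigcup_(i < k) P i by rewrite covP inE.
    by case/bigcupP => i _; exists i.
  pose c x : 'I_k := xchoose (inP x).
  have PE i : P i = [set x | c x == i :> nat].
    apply/setP => x; rewrite inE; apply/idP/eqP => [Px|/ord_inj<-].
      2: exact: (xchooseP (inP x)).
    apply/eqP; apply: contraT => ne; have := disjP (c x) i ne.
    by move/disjoint_setI0/setP/(_ x); rewrite !inE Px (xchooseP (inP x)).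
  exists (fun x => c x); split=> // i; case: (ltnP i k) => [lt_ik|le_ki].
    by have := clawP (Ordinal lt_ik); rewrite PE.
  apply: claw_number_induced_leq => x Y; rewrite inE => /eqP xi.
  by have := ltn_ord (c x); rewrite xi ltnNge le_ki.
exists (fun i : 'I_k => [set x | c x == i]); split=> //.
- move=> i j ne_ij; rewrite disjoint_subset; apply/subsetP => x.
  by rewrite !inE => /eqP->.
- by apply/setP => x; rewrite inE; apply/bigcupP; exists (Ordinal (ltck x)); rewrite ?inE.
Qed.

(** * Heights in an interval representation *)

Section Height.
Variables (R : realType) (G : sgraph) (l r : G -> R).
Hypothesis lt_lr : forall x, (l x < r x)%R.
Hypothesis adjE : forall x y, adj x y = [&& x != y, (l x < r y)%R & (l y < r x)%R].

Definition height (t : R) : nat :=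
  \max_(Y : {set G} | independent Y && [forall y in Y, (r y <= t)%R]) #|Y|.

Lemma leq_height t (Y : {set G}) :
  independent Y -> {in Y, forall y, (r y <= t)%R} -> #|Y| <= height t.
Proof.
move=> indY rY; apply: (@leq_bigmax_cond _ _ (fun Y : {set G} => #|Y|)).
by rewrite indY; apply/forall_inP.
Qed.

Lemma height_witness t : exists Y : {set G},
  [/\ independent Y, {in Y, forall y, (r y <= t)%R} & #|Y| = height t].
Proof.
have P0 : @independent G set0 && [forall y in (set0 : {set G}), (r y <= t)%R].
  by apply/andP; split; [apply/independentP => y|apply/forall_inP => y]; rewrite inE.
rewrite /height (bigop.bigmax_eq_arg (set0 : {set G})) //.
by case: arg_maxnP => // Y /andP[indY /forall_inP rY] _; exists Y.
Qed.

Lemma height_lt s t : height s < height t -> (s < t)%R.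
Proof.
rewrite ltNge; apply: contraTN => le_ts; rewrite -leqNgt.
have [Y [indY rY <-]] := height_witness t.
by apply: leq_height => // y /rY /le_trans; apply.
Qed.

Lemma le_height s t : (s <= t)%R -> height s <= height t.
Proof.
move=> le_st; rewrite leqNgt; apply/negP => /height_lt.
by rewrite ltNge le_st.
Qed.

(** A largest independent set ending by [l x] stays independent when [x] is added. *)
Lemma height_step x : height (l x) < height (r x).
Proof.
have [Y [/independentP indY rY <-]] := height_witness (l x).
have ltY y : y \in Y -> (r y <= l x)%R by apply: rY.
have adjF y : y \in Y -> adj x y = false.
  by move=> /ltY le_yx; rewrite adjE (ltNge (l x)) le_yx andbF.
have xNY : x \notin Y by apply/negP => /ltY; rewrite leNgt lt_lr.
have -> : #|Y|.+1 = #|x |: Y| by rewrite cardsU1 xNY.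
apply: leq_height => [|y].
  apply/independentP => y z; rewrite !inE.
  case/predU1P=> [->|Yy]; case/predU1P=> [->|Yz]; rewrite ?adj_irr ?adjF //.
    by rewrite adj_sym adjF.
  exact: indY.
by case/setU1P=> [->//|/ltY /le_trans]; apply; apply: ltW.
Qed.

(* In a largest independent set ending by [t], at most [height (l x)] members
   end by [l x]; drop them. *)
Lemma height_star x t : exists Y : {set G},
  [/\ independent Y, {in Y, forall y, (l x < r y <= t)%R} &
      height t - height (l x) <= #|Y|].
Proof.
have [Y [/independentP indY rY <-]] := height_witness t.
exists [set y in Y | (l x < r y)%R]; split.
- by apply/independentP => y z; rewrite !inE => /andP[Yy _] /andP[Yz _]; apply: indY.
- by move=> y; rewrite inE => /andP[/rY-> ->].
set Z := [set y in Y | _]; rewrite -(cardsID Z Y) leq_subLR.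
have /setIidPr-> : Z \subset Y by apply/subsetP => y; rewrite inE => /andP[].
rewrite addnC leq_add2r; apply: leq_height => [|y].
  by apply/independentP => y z; rewrite !inE => /andP[_ Yy] /andP[_ Yz]; apply: indY.
by rewrite !inE => /andP[+ Yy]; rewrite Yy /= -leNgt.
Qed.

(** In a largest independent set ending by [l y], the members that end after [l x] are neighbours of
    [x]. Adding [y] as one more leaf makes the bound strict. *)
Lemma height_adj x y : adj x y -> height (l x) < height (l y) ->
  height (l y) - height (l x) < claw_number G.
Proof.
move=> adjxy lt_xy; have ltl := height_lt lt_xy.
have [Y [/independentP indY rY /leq_ltn_trans]] := height_star x (l y); apply.
have ltyx : (l y < r x)%R by move: adjxy; rewrite adjE => /and3P[].
have adjF z : z \in Y -> adj y z = false.
  by move=> /rY /andP[_ le_zy]; rewrite adjE (ltNge (l y)) le_zy andbF.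
have yNY : y \notin Y by apply/negP => /rY /andP[_]; rewrite leNgt lt_lr.
have -> : #|Y|.+1 = #|y |: Y| by rewrite cardsU1 yNY.
apply: (leq_claw_number_set (x := x)) => [z|].
  case/setU1P=> [->//|/rY /andP[lt_xz le_zy]].
  rewrite adjE lt_xz (lt_trans (lt_le_trans (lt_lr z) le_zy) ltyx) andbT andbT.
  by apply: contraTneq le_zy => <-; rewrite -ltNge.
apply/independentP => u z; rewrite !inE.
case/predU1P=> [->|Yu]; case/predU1P=> [->|Yz]; rewrite ?adj_irr ?adjF //.
  by rewrite adj_sym adjF.
exact: indY.
Qed.

Lemma height_span x : height (r x) - height (l x) <= maxn 1 (claw_number G).
Proof.
have [Y [indY rY leY]] := height_star x (r x).
apply: (leq_trans leY).
have adjY y : y \in Y -> y != x -> adj x y.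
  move=> /rY /andP[lt_xy le_yx] ne; rewrite adjE eq_sym ne lt_xy.
  exact: lt_le_trans (lt_lr y) le_yx.
(* If [x] is in [Y], it meets every other member, so [Y] is a singleton; hence the 1 in the
   maximum. *)
case: (boolP (x \in Y)) => xY.
  suff -> : Y = [set x] by rewrite cards1 leq_maxl.
  apply/setP => y; rewrite inE; apply/idP/eqP => [Yy|->//].
  apply/eqP; apply: contraT => ne; move/independentP/(_ x y xY Yy): indY.
  by rewrite adjY.
rewrite leq_max; apply/orP; right; apply: (leq_claw_number_set (x := x)) => // y Yy.
by apply: adjY => //; apply: contraNneq xY => <-.
Qed.
End Height.

(* [a x] and [b x] are the first and the last index of the points of a stabbing
   sequence that lie in the interval [x]; adjacent intervals that share no such
   point meet between two consecutive ones. *)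
Definition stabbed (G : sgraph) (w : nat) (a b : G -> nat) : Prop :=
  [/\ forall x, a x <= b x <= a x + w.-1,
      forall x y, adj x y -> a y <= (b x).+1,
      forall x y, x != y -> a x <= b y -> a y <= b x -> adj x y
    & forall x y, adj x y -> a y < a x + w].

(** * Stabbing indices of interval graphs *)

Lemma setI_itvoo (R : realType) (a b c d : R) : (a < b)%R -> (c < d)%R ->
  (`]a, b[ `&` `]c, d[ !=set0)%classic <-> (a < d)%R && (c < b)%R.
Proof.
move=> ab cd; split=> [[z [/=]]|/andP[ad cb]].
  rewrite !in_itv /= => /andP[az zb] /andP[cz zd].
  by rewrite (lt_trans az zd) (lt_trans cz zb).
have lt_mm : (Num.max a c < Num.min b d)%R.
  by rewrite gt_max !lt_min ab ad cb cd.
exists ((Num.max a c + Num.min b d) / 2)%R.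
have := midf_lt lt_mm; rewrite gt_max lt_min => -[/andP[az cz] /andP[zb zd]].
by split; rewrite /= in_itv /= ?az ?cz ?zb ?zd.
Qed.

(** The points are never constructed: since [height] is monotone, comparing indices compares
    ends. *)
Lemma interval_graph_stabbed (R : realType) (G : sgraph) (w : nat) :
    0 < w -> interval_graph R G -> claw_number G <= w ->
  exists a b, stabbed (G := G) w a b.
Proof.
move=> w0 [l [r [lt_lr adjlr]]] clawG.
have adjE x y : adj x y = [&& x != y, (l x < r y)%R & (l y < r x)%R].
  have [->|ne] := eqVneq x y; first by rewrite adj_irr.
  apply/idP/idP; first by move/(adjlr _ _ ne)/(setI_itvoo (lt_lr x) (lt_lr y)).
  by move=> H; apply/(adjlr _ _ ne)/(setI_itvoo (lt_lr x) (lt_lr y)).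
pose h := height r.
exists (fun x => (h (l x)).+1), (fun x => h (r x)); split=> [x|x y|x y ne|x y].
- have := height_step lt_lr adjE x; have := height_span lt_lr adjE x.
  rewrite -/h; lia.
- by rewrite adjE => /and3P[_ _ lt_yx]; rewrite ltnS; apply: le_height; apply: ltW.
- by move=> /height_lt ltxy /height_lt ltyx; rewrite adjE ne ltxy.
- move=> /(height_adj lt_lr adjE); rewrite -/h; case: ltnP => [_ /(_ isT)|]; lia.
Qed.

(** * Clique covers and upper bounds *)

(** [g x] numbers cliques covering the neighbours of [x]; an independent set has at most one vertex
    in each. *)
Lemma claw_number_clique_cover (G : sgraph) (v : nat) (g : G -> G -> nat) :
    (forall x y, adj x y -> g x y < v) ->
    (forall x y z, adj x y -> adj x z -> y != z -> g x y = g x z -> adj y z) ->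
  claw_number G <= v.
Proof.
move=> ltgv g_adj; apply: claw_number_leq => x Y adjY /independentP indY.
have g_inj : {in enum Y &, injective (g x)}.
  move=> y z; rewrite !mem_enum => Yy Yz eq_g; apply/eqP.
  apply: contraT => ne; move/negP: (indY _ _ Yy Yz); case.
  by apply: (g_adj x); rewrite ?adjY.
rewrite cardE -(size_map (g x)) -(size_iota 0 v); apply: uniq_leq_size.
  by rewrite map_inj_in_uniq ?enum_uniq.
by move=> _ /mapP[y + ->]; rewrite mem_enum mem_iota => Yy; apply/ltgv/adjY.
Qed.

(** [f] names parts without edges between them, [g] the cliques within a part. *)
Lemma claw_number_parts (G : sgraph) (A : {set G}) (v : nat) (f g : G -> nat) :
    {in A, forall x, g x < v} ->
    {in A &, forall x y, adj x y -> f x = f y} ->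
    {in A &, forall x y, x != y -> f x = f y -> g x = g y -> adj x y} ->
  claw_number (induced A) <= v.
Proof.
move=> ltgv adjf fg_adj.
apply: (@claw_number_clique_cover (induced A) v (fun _ y => g (val y))).
  by move=> _ y _; apply: ltgv (valP y).
move=> x y z adjxy adjxz ne; apply: fg_adj (valP y) (valP z) ne _.
by rewrite -(adjf _ _ (valP x) (valP y) adjxy); apply: adjf (valP x) (valP z) adjxz.
Qed.

Lemma block_partition (G : sgraph) (w k v : nat) (a b : G -> nat) :
  0 < v -> 0 < k -> w <= (k.-1 * v).+1 -> stabbed w a b -> claw_partition G k v.
Proof.
move=> v0 k0 le_w [spanG _ shareG stepG]; apply/claw_partitionP.
exists (fun x => a x %/ v %% k); split=> [x|i]; first exact: ltn_pmod.
apply: (claw_number_parts (f := fun x => a x %/ v) (g := fun x => a x %% v)).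
- by move=> x _; apply: ltn_pmod.
- move=> x y; rewrite !inE => /eqP <- /eqP + adjxy.
  wlog le_xy : x y adjxy / a x <= a y => [H|].
    case: (leqP (a x) (a y)) => [/H|/ltnW /H]; first exact.
    by rewrite adj_sym => /(_ adjxy) + /esym E => /(_ E) ->.
  move=> eq_k; apply/eqP; rewrite eqn_leq leq_div2r //= leqNgt; apply/negP => lt_xy.
  (* Distinct blocks of one colour are at least [k] apart, so [a y - a x] is at least
     [(k - 1) * v + 1], against [stepG]. *)
  have lt_k : a x %/ v + k <= a y %/ v.
    rewrite -leq_subRL ?(ltnW lt_xy) //; apply: dvdn_leq; first by rewrite subn_gt0.
    by rewrite -eqn_mod_dvd ?(ltnW lt_xy) // eq_k.
  have := stepG _ _ adjxy; have := divn_eq (a x) v; have := divn_eq (a y) v.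
  have := ltn_pmod (a x) v0; have := ltn_pmod (a y) v0.
  move: le_w lt_k; rewrite -(prednK k0) addnS; nia.
- move=> x y _ _ ne eq_f eq_g.
  have eq_a : a x = a y by rewrite (divn_eq (a x) v) eq_f eq_g -divn_eq.
  by have := spanG x; have := spanG y; rewrite eq_a => /andP[? _] /andP[? _]; apply: shareG; lia.
Qed.

(** Non-adjacent intervals share no index, so sorting by [a] separates them. *)
Lemma independent_chain (G : sgraph) (w : nat) (a b : G -> nat) (Y : {set G}) :
    stabbed w a b -> independent Y ->
  exists s : seq G, [/\ size s = #|Y|, {subset s <= Y}
                      & pairwise (fun x y => b x < a y) s].
Proof.
case=> spanG _ shareG _ /independentP indY.
pose s := sort (relpre a leq) (enum Y); exists s.
have sY : {subset s <= Y} by move=> x; rewrite mem_sort mem_enum.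
split=> //; first by rewrite size_sort cardE.
have : pairwise [rel x y | (x != y) && (a x <= a y)] s.
  rewrite (pairwise_relI (fun x y => x != y)) -uniq_pairwise sort_uniq enum_uniq.
  rewrite -sorted_pairwise; last by move=> ? ? ?; apply: leq_trans.
  by apply: sort_sorted => x y; apply: leq_total.
apply: (sub_in_pairwise (P := mem Y)); last exact/allP.
move=> x y Yx Yy /andP[ne le_xy]; rewrite ltnNge; apply: contra (indY x y Yx Yy) => le_yx.
by apply: shareG => //; have := spanG y; lia.
Qed.

Lemma cut_partition_6_2 (G : sgraph) (a b : G -> nat) :
  stabbed 6 a b -> claw_partition G 3 2.
Proof.
move=> stab; have [spanG touchG shareG _] := stab; apply/claw_partitionP.
(* [last m x] is the largest multiple of [m] that is at most [b x], so that
   [a x <= last m x] says that [x] contains a point whose index is a multiple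
   of [m]. *)
pose last m (x : G) := b x %/ m * m.
pose c x := if a x <= last 9 x then 0 else if a x <= last 3 x then 1 else 2.
exists c; split=> [x|i].
  by rewrite /c; case: ifP => // _; case: ifP.
have [->|i0] := eqVneq i 0.
  apply: claw_number_induced_leq => x Y _ /subsetP sYA adjY indY.
  rewrite leqNgt; apply/negP; have [s [<- sY]] := independent_chain stab indY.
  case: s sY => [|y1 [|y2 [|y3 s]]] //= sY.
  have Y1 : y1 \in Y by apply: sY; rewrite !inE eqxx.
  have Y2 : y2 \in Y by apply: sY; rewrite !inE eqxx ?orbT.
  have Y3 : y3 \in Y by apply: sY; rewrite !inE eqxx ?orbT.
  have cE y : y \in Y -> a y <= last 9 y.
    by move/sYA; rewrite inE /c; case: ifP => // _; case: ifP.
  (* Let [m] be the multiple of 9 in [y1]. Then [a y3 <= b x + 1 <= a x + 6 <= b y1 + 7 <= m + 12],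
     but [y3] contains a multiple of 9 that is at least [m + 18], so [a y3 >= m + 13]. *)
  move: (cE _ Y1) (cE _ Y2) (cE _ Y3) (spanG x) (spanG y1) (spanG y2) (spanG y3).
  have := touchG _ _ (adjY _ Y3); have := adjY _ Y1; rewrite adj_sym => /touchG.
  rewrite /last; lia.
have [->|i1] := eqVneq i 1.
  have cE x : x \in [set x | c x == 1] -> (last 9 x < a x) && (a x <= last 3 x).
    by rewrite inE /c; case: ifP => //; case: ifP => //; lia.
  (* Each interval here contains an index that is 3 or 6 modulo 9: two cliques per part. *)
  apply: (claw_number_parts (f := fun x => a x %/ 9)
    (g := fun x => if a x %% 9 <= 3 then 0 else 1)).
  - by move=> x _; case: ifP.
  - move=> x y /cE cx /cE cy adjxy; have := touchG _ _ adjxy.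
    rewrite adj_sym in adjxy; have := touchG _ _ adjxy.
    have := spanG x; have := spanG y; move: cx cy; rewrite /last; lia.
  - move=> x y /cE cx /cE cy ne eq_f eq_g; apply: shareG => //;
    have := spanG x; have := spanG y; move: cx cy eq_f eq_g; rewrite /last;
    case: ifP; case: ifP; lia.
have cE x : x \in [set x | c x == i] -> (last 3 x < a x).
  by rewrite inE /c; case: ifP; [lia|case: ifP; [lia|]]; lia.
(* Only indices 1 and 2 modulo 3 remain; across a cut they differ by at least 2, so intervals on its
   two sides do not even touch. *)
apply: (claw_number_parts (f := fun x => a x %/ 3) (g := fun x => (a x %% 3).-1)).
- by move=> x _; lia.
- move=> x y /cE cx /cE cy adjxy; have := touchG _ _ adjxy.
  rewrite adj_sym in adjxy; have := touchG _ _ adjxy.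
  have := spanG x; have := spanG y; move: cx cy; rewrite /last; lia.
- move=> x y /cE cx /cE cy ne eq_f eq_g; apply: shareG => //;
  have := spanG x; have := spanG y; move: cx cy eq_f eq_g; rewrite /last; lia.
Qed.

Lemma cut_partition_5_3 (G : sgraph) (a b : G -> nat) :
  stabbed 5 a b -> claw_partition G 2 3.
Proof.
move=> stab; have [spanG touchG shareG stepG] := stab; apply/claw_partitionP.
pose last (x : G) := b x %/ 4 * 4.
pose c x := if a x <= last x then 0 else 1.
exists c; split=> [x|i]; first by rewrite /c; case: ifP.
have [->|i0] := eqVneq i 0.
  apply: claw_number_induced_leq => x Y _ /subsetP sYA adjY indY.
  rewrite leqNgt; apply/negP; have [s [<- sY]] := independent_chain stab indY.
  case: s sY => [|y1 [|y2 [|y3 [|y4 s]]]] //= sY.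
  have Y1 : y1 \in Y by apply: sY; rewrite !inE eqxx.
  have Y2 : y2 \in Y by apply: sY; rewrite !inE eqxx ?orbT.
  have Y3 : y3 \in Y by apply: sY; rewrite !inE eqxx ?orbT.
  have Y4 : y4 \in Y by apply: sY; rewrite !inE eqxx ?orbT.
  have cE y : y \in Y -> a y <= last y.
    by move/sYA; rewrite inE /c; case: ifP.
  (* [a x <= b y1 + 1 <= a y2] and the multiples of 4 in [y2] and [y3] give [a y4 >= a x + 5],
     against [stepG]; touching alone would only give [a y4 <= a x + 5]. *)
  move: (cE _ Y2) (cE _ Y3) (spanG x) (spanG y1) (spanG y2) (spanG y3) (spanG y4).
  have := touchG _ _ (adjY _ Y4); have := adjY _ Y1; rewrite adj_sym => /touchG.
  have := stepG _ _ (adjY _ Y4); rewrite /last; lia.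
have cE x : x \in [set x | c x == i] -> (last x < a x).
  by rewrite inE /c; case: ifP; lia.
apply: (claw_number_parts (f := fun x => a x %/ 4) (g := fun x => (a x %% 4).-1)).
- by move=> x _; lia.
- move=> x y /cE cx /cE cy adjxy; have := touchG _ _ adjxy.
  rewrite adj_sym in adjxy; have := touchG _ _ adjxy.
  have := spanG x; have := spanG y; move: cx cy; rewrite /last; lia.
- move=> x y /cE cx /cE cy ne eq_f eq_g; apply: shareG => //;
  have := spanG x; have := spanG y; move: cx cy eq_f eq_g; rewrite /last; lia.
Qed.

(** * Grid graphs for the lower bounds *)

Section Grid.
Variables K w N : nat.

Definition grid_interval : pred (nat * nat) :=
  fun p => (K <= p.2 - p.1 <= (w.-1 * K).+1) && (p.2 <= N).

Definition grid_vertex : finType :=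
  {p : 'I_N.+1 * 'I_N.+1 | grid_interval (p.1 : nat, p.2 : nat)}.

Definition grid_pos (x : grid_vertex) : nat * nat := ((val x).1 : nat, (val x).2 : nat).

Arguments grid_pos : simpl never.

Definition overlap (p q : nat * nat) : bool := [&& p != q, p.1 < q.2 & q.1 < p.2].

Definition grid_adj : rel grid_vertex := fun x y => overlap (grid_pos x) (grid_pos y).

Lemma grid_pos_inj : injective grid_pos.
Proof.
move=> [[i j] gx] [[i' j'] gy] [/ord_inj E1 /ord_inj E2].
by apply: val_inj; rewrite /= E1 E2.
Qed.

Lemma grid_adj_sym : symmetric grid_adj.
Proof. by move=> x y; rewrite /grid_adj /overlap eq_sym [X in _ && X]andbC. Qed.

Lemma grid_adj_irr : irreflexive grid_adj.
Proof. by move=> x; rewrite /grid_adj /overlap eqxx. Qed.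

Definition grid : sgraph := SGraph grid_adj_sym grid_adj_irr.

Lemma grid_posP (x : grid) : grid_interval (grid_pos x).
Proof. exact: valP x. Qed.

Hypothesis K_gt0 : 0 < K.

Lemma grid_lt (x : grid) : (grid_pos x).1 < (grid_pos x).2.
Proof. by have := grid_posP x; rewrite /grid_interval; lia. Qed.

Lemma grid_pos_onto p : grid_interval p -> exists x : grid, grid_pos x = p.
Proof.
case: p => i j gp; have := gp; rewrite /grid_interval /= => /andP[le_ij le_j].
have lt_i : i < N.+1 by lia.
by exists (exist _ (Ordinal lt_i, Ordinal (le_j : j < N.+1)) gp).
Qed.

Lemma interval_graph_grid (R : realType) : interval_graph R grid.
Proof.
pose l (x : grid) : R := ((grid_pos x).1%:R)%R; pose r (x : grid) : R := ((grid_pos x).2%:R)%R.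
have lt_lr x : (l x < r x)%R by rewrite ltr_nat grid_lt.
exists l, r; split=> // x y ne.
rewrite (setI_itvoo (lt_lr x) (lt_lr y)) !ltr_nat /= /grid_adj /overlap.
by rewrite (inj_eq grid_pos_inj) ne.
Qed.

Lemma claw_number_grid : 0 < w -> claw_number grid <= w.
Proof.
move=> w_gt0.
(* The neighbours of [x] are covered by the [w] cliques formed by the intervals
   containing the unit cell at [x.1 + g * K], for [g < w]. *)
pose g (x y : grid) := minn (((grid_pos y).2 - (grid_pos x).1).-1 %/ K) w.-1.
have cell (x y : grid) : adj x y ->
    (grid_pos y).1 <= (grid_pos x).1 + g x y * K < (grid_pos y).2.
  case/and3P => _; have := grid_posP x; have := grid_posP y.
  rewrite /g /grid_interval; move: (grid_pos x) (grid_pos y) => [l r] [l' r'] /=.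
  have := divn_eq (r' - l).-1 K; have := ltn_pmod (r' - l).-1 K_gt0.
  (* If [q <= w - 1], the cell starts at most [K] before the right end of [y], whose length is at
     least [K]. Otherwise it starts no earlier than the last unit cell of [x], hence not before
     [y]. *)
  move: (_ %/ _) (_ %% _) => q m; case: (leqP q w.-1) => [|/ltnW]; first by lia.
  by move=> /(leq_mul (leqnn K)); lia.
apply: (claw_number_clique_cover (g := g)) => [x y _|x y z]; first by rewrite /g; lia.
move=> /cell xy /cell xz ne eq_g; apply/and3P; split; first by rewrite (inj_eq grid_pos_inj).
  by move: xy xz; rewrite eq_g; lia.
by move: xy xz; rewrite eq_g; lia.
Qed.
End Grid.

(** * Exhaustive search and its soundness *)

(** Leaves are sought from left to right, [e] being the end of the last one chosen. *)
Fixpoint chain (s e : nat) (S : seq (nat * nat)) : bool :=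
  if s is s'.+1 then has (fun p => (e <= p.1) && chain s' p.2 S) S
  else true.

Definition has_star (s : nat) (S : seq (nat * nat)) : bool :=
  has (fun x => chain s 0 [seq y <- S | overlap x y]) S.

(* Backtracking over the 2-colourings of a grid, [S] and [T] being the colour
   classes so far and [S] the last one extended; [c] lists the intervals on
   which to branch, in prefix order, and what is left of it is returned. *)
Fixpoint refute (K w N s n : nat) (S T c : seq (nat * nat)) : option (seq (nat * nat)) :=
  if has_star s S then Some c
  else if n is n'.+1 then
    if c is p :: c' then
      if grid_interval K w N p then
        if refute K w N s n' (p :: S) T c' is Some c'' then
          refute K w N s n' (p :: T) S c''
        else None
      else None
    else None
  else None.

Section Refute.
Variables (K w N : nat).
Hypothesis K_gt0 : 0 < K.
Notation G := (grid K w N).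

(** Only an inclusion: the search knows just part of a class. *)
Definition positions (A : {set G}) (S : seq (nat * nat)) : Prop :=
  forall p, p \in S -> exists2 x, x \in A & grid_pos x = p.

Lemma chain_independent (A : {set G}) s e S : positions A S -> chain s e S ->
  exists Y : {set G}, [/\ #|Y| = s, independent Y, Y \subset A &
    {in Y, forall y, (grid_pos y \in S) && (e <= (grid_pos y).1)}].
Proof.
move=> posS; elim: s e => [|s IH] e /=.
  by exists set0; split; rewrite ?cards0 ?sub0set //; [apply/independentP => y|move=> y];
     rewrite inE.
case/hasP => p Sp /andP[le_ep /IH[Y [cY /independentP indY sYA posY]]].
have [x Ax xp] := posS _ Sp; have lt_p := grid_lt K_gt0 x; rewrite xp in lt_p.
have adjF y : y \in Y -> adj x y = false.
  by move=> /posY /andP[_ le_py]; rewrite /= /grid_adj /overlap xp (ltnNge _ p.2) le_py !andbF.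
have xNY : x \notin Y by apply/negP => /posY /andP[_]; rewrite xp leqNgt lt_p.
exists (x |: Y); split.
- by rewrite cardsU1 xNY cY.
- apply/independentP => y z; rewrite !inE.
  case/predU1P=> [->|Yy]; case/predU1P=> [->|Yz]; rewrite ?adj_irr ?adjF //.
    by rewrite adj_sym adjF.
  exact: indY.
- by rewrite subUset sub1set Ax.
- move=> y /setU1P[->|/posY /andP[-> le_py]]; first by apply/andP; rewrite -xp in Sp le_ep.
  exact: leq_trans le_ep (leq_trans (ltnW lt_p) le_py).
Qed.

Lemma has_star_claw_number (A : {set G}) s S :
  positions A S -> has_star s S -> s <= claw_number (induced A).
Proof.
move=> posS /hasP[p /posS[x Ax <-] /chain_independent].
case/(_ A) => [q|Y [<- indY sYA posY]].
  by rewrite mem_filter => /andP[_ /posS].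
apply: (leq_claw_number_induced Ax sYA) => // y /posY.
by rewrite mem_filter => /andP[/andP[]].
Qed.

Lemma positions_cons (A : {set G}) x S :
  x \in A -> positions A S -> positions A (grid_pos x :: S).
Proof. by move=> Ax posS p; rewrite inE => /predU1P[->|/posS //]; exists x. Qed.

(** The interval branched on lies in [A] or in [B]; following that branch leads to a star inside one
    of them. *)
Lemma refute_claw_number s n S T c (A B : {set G}) :
    A :|: B = setT -> positions A S -> positions B T -> refute K w N s n S T c ->
  s <= maxn (claw_number (induced A)) (claw_number (induced B)).
Proof.
elim: n S T c A B => [|n IH] S T c A B /= AB posS posT.
  by case: ifP => // /(has_star_claw_number posS) le_s _; rewrite leq_max le_s.
case: ifP => [/(has_star_claw_number posS) le_s _|_]; first by rewrite leq_max le_s.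
case: c => // p c; case: ifP => // /(grid_pos_onto K_gt0)[x xp].
have /setUP[Ax|Bx] : x \in A :|: B by rewrite AB inE.
  have posS' := positions_cons Ax posS; rewrite xp in posS'.
  by case E: refute => [c'|] // _; apply: (IH _ _ c _ _ AB posS' posT); rewrite E.
have posT' := positions_cons Bx posT; rewrite xp in posT'.
by case: refute => // c'; rewrite maxnC; apply: IH posT' posS; rewrite setUC.
Qed.

Lemma refute_not_kappa_bound (R : realType) v w' n p c j :
    0 < w <= w' -> grid_interval K w N p -> refute K w N v.+1 n [:: p] [::] c ->
  kappa_bound R w' v j -> 2 < j.
Proof.
case/andP=> w_gt0 le_w /(grid_pos_onto K_gt0)[x xp] ref bound; rewrite ltnNge; apply/negP => le_j.
have /claw_partitionP[col [lt_col claw_col]] :=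
  bound G (interval_graph_grid w N K_gt0 R) (leq_trans (claw_number_grid N K_gt0 w_gt0) le_w).
(* The first class is that of the root [p], whichever colour it has. *)
have /refute_claw_number : positions [set y | col y == col x] [:: p].
  by rewrite -xp; apply: positions_cons => [|q]; rewrite ?inE.
move=> /(_ _ _ _ _ [set y | col y == 1 - col x]) H.
suff : v < v by rewrite ltnn.
apply: (leq_trans (H _ _ _ _ _ _ ref)) => //; last by rewrite geq_max !claw_col.
apply/setP => y; rewrite !inE; have := lt_col x; have := lt_col y; lia.
Qed.

Lemma has_star_not_kappa_bound (R : realType) v w' S j :
    0 < w <= w' -> all (grid_interval K w N) S -> has_star v.+1 S ->
  kappa_bound R w' v j -> 1 < j.
Proof.
case/andP=> w_gt0 le_w /allP gridS starS bound; rewrite ltnNge; apply/negP => le_j.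
have /claw_partitionP[col [lt_col claw_col]] :=
  bound G (interval_graph_grid w N K_gt0 R) (leq_trans (claw_number_grid N K_gt0 w_gt0) le_w).
suff posS : positions [set y | col y == 0] S.
  by have := leq_trans (has_star_claw_number posS starS) (claw_col 0); rewrite ltnn.
move=> p /gridS /(grid_pos_onto K_gt0)[x xp]; exists x => //.
by rewrite inE; have := lt_col x; lia.
Qed.
End Refute.

(** * The values of kappa *)

Lemma kappa_bound_of_stabbed (R : realType) w v k : 0 < w ->
    (forall (G : sgraph) (a b : G -> nat), stabbed w a b -> claw_partition G k v) ->
  kappa_bound R w v k.
Proof.
move=> w_gt0 H G intG clawG.
by have [a [b stab]] := interval_graph_stabbed w_gt0 intG clawG; apply: H stab.
Qed.

Lemma kappa_bound_block (R : realType) w v k :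
  0 < w -> 0 < v -> 0 < k -> w <= (k.-1 * v).+1 -> kappa_bound R w v k.
Proof.
move=> w0 v0 k0 le_w; apply: kappa_bound_of_stabbed => // G a b.
exact: block_partition.
Qed.

Lemma kappa_bound_6_2 (R : realType) w : w <= 6 -> kappa_bound R w 2 3.
Proof.
move=> le_w G intG clawG; apply: (@kappa_bound_of_stabbed R 6) intG (leq_trans clawG le_w) => //.
exact: cut_partition_6_2.
Qed.

(* Found by a lookahead search outside Rocq, for the root (7, 14). *)
Definition branching_2_4_22 : seq (nat * nat) :=
  [:: (9, 11); (7, 9); (11, 13); (11, 14); (12, 16); (12, 17); (12, 18); (12, 19);
    (13, 15); (13, 20); (15, 17); (15, 19); (16, 18); (16, 20); (17, 19); (18, 20);
    (19, 21); (14, 16); (2, 9); (6, 8); (8, 10); (0, 3); (1, 5); (2, 4); (2, 6); (3, 5);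
    (4, 6); (5, 7); (1, 8); (0, 2); (8, 15); (10, 12); (12, 14); (12, 15); (13, 17);
    (13, 18); (13, 19); (13, 20); (14, 16); (14, 21); (16, 18); (16, 20); (17, 19);
    (17, 21); (18, 20); (19, 21); (20, 22); (15, 17); (5, 7); (5, 11); (0, 3); (1, 5);
    (2, 4); (3, 5); (4, 11); (2, 6); (1, 7); (0, 2); (12, 14); (6, 13); (3, 8); (4, 9);
    (5, 8); (14, 16); (14, 18); (14, 21); (0, 7); (12, 17); (12, 18); (12, 19);
    (10, 17); (5, 11); (4, 11); (15, 17); (15, 19); (15, 21); (16, 18); (2, 6); (3, 5);
    (18, 20); (20, 22); (0, 3); (17, 21); (8, 13); (13, 15); (16, 18); (16, 21);
    (18, 20); (20, 22); (17, 19); (11, 18); (5, 12); (8, 12); (2, 6); (3, 5); (0, 3);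
    (6, 13); (10, 15); (10, 16); (11, 18); (14, 18); (15, 17); (17, 19); (0, 3); (1, 5);
    (2, 4); (2, 6); (3, 5); (4, 6); (5, 7); (1, 8); (0, 2); (11, 13); (11, 14);
    (12, 16); (12, 17); (12, 18); (13, 15); (13, 20); (15, 17); (16, 20); (17, 19);
    (8, 15); (19, 21); (14, 18); (11, 13); (11, 14); (12, 16); (12, 17); (12, 18);
    (13, 15); (13, 20); (15, 17); (16, 20); (17, 19); (8, 15); (19, 21); (14, 18);
    (10, 12); (11, 13); (8, 15); (13, 15); (13, 17); (13, 18); (13, 19); (13, 20);
    (14, 16); (14, 21); (16, 18); (16, 20); (17, 19); (17, 21); (18, 20); (19, 21);
    (20, 22); (15, 17); (6, 13); (9, 16); (10, 17); (8, 10); (0, 7); (3, 7); (4, 8);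
    (5, 7); (6, 8); (5, 12); (0, 6); (4, 6); (5, 10); (3, 10); (4, 11); (0, 4); (0, 5);
    (7, 9); (7, 9); (8, 12); (7, 12); (6, 12); (8, 14); (5, 12); (5, 7); (7, 10);
    (12, 14); (12, 16); (12, 17); (12, 19); (9, 13); (13, 15); (4, 9); (1, 8); (5, 8);
    (7, 11); (4, 11); (0, 5); (15, 19); (16, 18); (18, 20); (6, 10); (5, 10); (4, 11);
    (2, 6); (0, 5); (3, 5); (3, 8); (2, 9); (0, 3); (0, 7); (3, 7); (5, 7); (5, 11);
    (4, 11); (2, 6); (4, 6); (0, 5); (3, 5); (4, 9); (2, 9); (3, 10); (0, 3); (0, 4);
    (6, 8); (13, 15); (15, 17); (13, 15); (13, 17); (13, 18); (13, 20); (14, 16);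
    (15, 17); (16, 20); (17, 19); (19, 21); (12, 17); (1, 8); (2, 7); (3, 8); (4, 7);
    (4, 8); (5, 7); (5, 9); (6, 8); (0, 2); (2, 4); (1, 5); (4, 6); (13, 15); (1, 8);
    (7, 11); (8, 10); (13, 20); (15, 17); (9, 16); (10, 17); (11, 18); (17, 19);
    (17, 21); (18, 20); (19, 21); (13, 16); (20, 22); (16, 20); (15, 21); (9, 16);
    (4, 11); (5, 10); (6, 11); (7, 10); (7, 11); (8, 10); (0, 5); (5, 7); (1, 8);
    (3, 10); (4, 10); (6, 10); (7, 10); (8, 10); (15, 19); (15, 20); (15, 21); (13, 19);
    (1, 8); (4, 8); (6, 8); (5, 12); (11, 15); (11, 16); (11, 18); (17, 19); (19, 21);
    (16, 18); (14, 21); (18, 20); (10, 17); (20, 22); (0, 6); (0, 7); (1, 7); (2, 6);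
    (3, 7); (4, 6); (5, 7); (5, 11); (0, 2); (0, 4); (2, 4); (10, 17); (1, 5); (16, 18);
    (16, 20); (7, 9); (7, 13); (9, 12); (9, 13); (9, 14); (9, 15); (12, 14); (14, 16);
    (18, 20); (12, 19); (11, 16); (11, 18); (6, 13); (17, 19); (19, 21); (12, 19);
    (14, 16); (18, 20); (1, 8); (7, 11); (8, 10); (12, 14); (2, 9); (3, 8); (4, 10);
    (5, 8); (5, 10); (6, 8); (6, 10); (7, 9); (8, 10); (3, 5); (2, 6); (5, 7); (0, 3);
    (6, 13); (0, 7); (1, 8); (2, 7); (3, 8); (4, 7); (4, 8); (5, 7); (7, 9); (0, 2);
    (2, 4); (1, 5); (4, 11); (12, 15); (0, 7); (6, 10); (7, 9); (12, 19); (13, 15);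
    (14, 16); (8, 15); (9, 16); (10, 17); (16, 18); (16, 20); (17, 19); (18, 20);
    (19, 21); (15, 19); (14, 20); (8, 15); (3, 10); (4, 9); (5, 10); (6, 9); (6, 10);
    (7, 9); (0, 4); (4, 6); (0, 7); (2, 9); (4, 9); (6, 9); (7, 9); (14, 20); (14, 21);
    (12, 17); (13, 19); (13, 20); (0, 7); (3, 7); (5, 7); (10, 17); (15, 19); (16, 18);
    (18, 20); (11, 17); (8, 13); (9, 13); (5, 12); (0, 6); (2, 6); (4, 6); (6, 8);
    (0, 4); (3, 10); (3, 5); (0, 3); (16, 18); (16, 21); (18, 20); (19, 21); (20, 22);
    (17, 19); (3, 10); (4, 8); (5, 10); (6, 8); (6, 10); (7, 9); (0, 4); (4, 6); (0, 7);
    (0, 7); (6, 10); (7, 9)].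

Theorem theorem3 (R : realType) :
  is_kappa R 2 1 2 /\
  is_kappa R 3 1 3 /\
  is_kappa R 3 2 2 /\
  (is_kappa R 4 2 3 /\ is_kappa R 5 2 3 /\ is_kappa R 6 2 3) /\
  is_kappa R 5 3 2.
Proof.
have lower_4 w j : 4 <= w -> kappa_bound R w 2 j -> 2 < j.
  (* One grid of claw number at most 4 serves [w = 4, 5, 6]; [100] bounds the search depth. *)
  by move=> le_w; apply: (@refute_not_kappa_bound 2 4 22 isT R 2 w 100 (7, 14) branching_2_4_22).
split; [|split; [|split; [|split; [split; [|split]|]]]]; split=> [|j].
- exact: kappa_bound_block.
(* A star with 2 leaves, so one class is not enough. *)
- exact: (@has_star_not_kappa_bound 1 2 2 isT R 1 2 [:: (0, 2); (0, 1); (1, 2)]).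
- exact: kappa_bound_block.
- exact: (@refute_not_kappa_bound 1 3 5 isT R 1 3 6 (2, 5)
    [:: (0, 3); (0, 1); (0, 2); (1, 2); (2, 3); (0, 1); (0, 2); (1, 2); (3, 4); (3, 5); (4, 5)]).
- exact: kappa_bound_block.
- exact: (@has_star_not_kappa_bound 1 3 3 isT R 2 3 [:: (0, 3); (0, 1); (1, 2); (2, 3)]).
- exact: kappa_bound_6_2.
- exact: lower_4.
- exact: kappa_bound_6_2.
- exact: lower_4.
- exact: kappa_bound_6_2.
- exact: lower_4.
- apply: kappa_bound_of_stabbed => // G a b; exact: cut_partition_5_3.
- exact: (@has_star_not_kappa_bound 1 5 4 isT R 3 5
    [:: (0, 4); (0, 1); (1, 2); (2, 3); (3, 4)]).
Qed.
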